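(* For every $n\ge 1$, $|\mathcal{DRS}_n(132)|=S_n$, where $S_n$ is the number of Motzkin paths of length $n$ with no two consecutive up steps.
   Context: For $\sigma\in\mathfrak{S}_n$, a double descent is an index $i$ with $\sigma_i>\sigma_{i+1}>\sigma_{i+2}$. The permutation $\sigma$ is simsun if for every $k$, the subword of $\sigma$ consisting of the letters in $\{1,\dots,k\}$ (in the order they appear in $\sigma$) has no double descent. For $\omega\in\mathfrak{S}_t$, $\sigma$ contains an $\omega$-pattern if there are indices $i_1<\cdots<i_t$ with $\sigma_{i_j}<\sigma_{i_k}$ iff $\omega_j<\omega_k$; otherwise $\sigma$ avoids $\omega$. $\mathcal{DRS}_n(\omega)$ is the set of $\sigma\in\mathfrak{S}_n$ such that $\sigma$ is $\omega$-avoiding and simsun and $\sigma^{-1}$ is simsun. A Motzkin path of length $n$ is a lattice path from $(0,0)$ to $(n,0)$ with up steps $(1,1)$, down steps $(1,-1)$ and level steps $(1,0)$ never going below the $x$-axis. *)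

(* Defs.v *)
From HB Require Import structures.
From mathcomp Require Import all_boot all_order all_algebra all_fingroup.

Set Implicit Arguments.
Unset Strict Implicit.
Unset Printing Implicit Defensive.

Import Order.TTheory GRing.Theory Num.Theory.

(* A permutation of {1, ..., n} is an element s of 'S_n, which permutes the
   positions {0, ..., n-1}; its one-line notation is
   (s 0).+1, (s 1).+1, ..., (s (n-1)).+1. *)
Definition oneline (n : nat) (s : 'S_n) : seq nat :=
  [seq (s i : nat).+1 | i <- enum 'I_n].

Definition has_double_descent (w : seq nat) : bool :=
  [exists i : 'I_(size w),
     [&& i.+2 < size w, nth 0 w i > nth 0 w i.+1
       & nth 0 w i.+1 > nth 0 w i.+2]].

Definition subword (k : nat) (w : seq nat) : seq nat :=
  [seq a <- w | 1 <= a <= k].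

Definition simsun (n : nat) (s : 'S_n) : bool :=
  [forall k : 'I_n.+1, ~~ has_double_descent (subword k (oneline s))].

Definition contains_pattern (t n : nat) (w : 'S_t) (s : 'S_n) : bool :=
  [exists f : {ffun 'I_t -> 'I_n},
     [forall j : 'I_t, forall k : 'I_t, (j < k) ==> (f j < f k)] &&
     [forall j : 'I_t, forall k : 'I_t, (s (f j) < s (f k)) == (w j < w k)]].

Definition avoids (t n : nat) (w : 'S_t) (s : 'S_n) : bool :=
  ~~ contains_pattern w s.

Definition DRS (n t : nat) (w : 'S_t) : {set 'S_n} :=
  [set s : 'S_n | [&& avoids w s, simsun s & simsun s^-1%g]].

Definition p132 : 'S_3 := tperm (inord 1) (inord 2).

Lemma oneline_p132 : oneline p132 = [:: 1; 3; 2].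
Proof.
have szE : size (oneline p132) = 3 by rewrite size_map size_enum_ord.
apply: (@eq_from_nth _ 0) => // i; rewrite szE => lti3.
rewrite (nth_map ord0) ?size_enum_ord //.
rewrite (_ : nth ord0 (enum 'I_3) i = Ordinal lti3); last first.
  by apply: val_inj; rewrite /= nth_enum_ord.
rewrite permE /= -!val_eqE /= !inordK //.
by case: i lti3 => [|[|[|]]] //= _; rewrite inordK.
Qed.

Inductive step : Type := Up | Down | Level.

Definition ord_of_step (a : step) : 'I_3 :=
  match a with Up => inord 0 | Down => inord 1 | Level => inord 2 end.

Definition step_of_ord (i : 'I_3) : step :=
  match val i with 0 => Up | 1 => Down | _ => Level end.

Lemma ord_of_stepK : cancel ord_of_step step_of_ord.
Proof. by case; rewrite /step_of_ord /= inordK. Qed.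

HB.instance Definition _ := Finite.copy step (can_type ord_of_stepK).

(* Every step has horizontal component 1, so after k steps a path starting at
   (0,0) is at (k, height p k). *)
Definition rise (a : step) : int :=
  match a with Up => 1%R | Down => (-1)%R | Level => 0%R end.

Definition height (p : seq step) (k : nat) : int :=
  (\sum_(a <- take k p) rise a)%R.

Definition motzkin (n : nat) (p : n.-tuple step) : bool :=
  [forall k : 'I_n.+1, (0 <= height p k)%R] && (height p n == 0%R).

Definition no_consecutive_up (p : seq step) : bool :=
  ~~ [exists i : 'I_(size p),
        [&& i.+1 < size p, nth Level p i == Up & nth Level p i.+1 == Up]].

Definition motzkin_no_UU (n : nat) : nat :=
  #|[set p : n.-tuple step | motzkin p && no_consecutive_up p]|.

(* Main.v *)
Require Import Defs.
From mathcomp Require Import all_boot all_order all_algebra all_fingroup.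
From mathcomp Require Import zify.

(** A permutation avoiding 132 is a word [L m R] with [m] its maximum and every
letter of [L] above every letter of [R]. It and its inverse are both simsun iff
the same holds of [L] and [R] and, when [R] is nonempty, [R] does not begin with
a descent and (if [L] is nonempty) the two least letters of [L] occur in
increasing order. Avoidance of 132 then makes the two letters concerned adjacent
both in position and in value, and merging them into one is a bijection onto all
smaller doubly simsun permutations. So the class satisfies
[M = 1 + z M + z^2 M + z^3 M^2], as do the UU-free Motzkin paths: with [H] the
level step these are empty, [H p], [U D p] or [U H p D q]. Both are put in
bijection with the same family of trees. *)

Set Implicit Arguments.
Unset Strict Implicit.
Unset Printing Implicit Defensive.

Import GRing.Theory.

(** * Pattern conditions on words and their invariance under relabelling *)

Definition av132 (w : seq nat) : Prop := forall x y z : nat,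
  x \in w -> y \in w -> z \in w ->
  index x w < index y w -> index y w < index z w -> x < z -> z < y -> False.

(* [x y z] is a double descent of the subword of the letters at most [x] as soon
as every letter strictly between them in position, other than [y], exceeds
[x]. *)
Definition sim (w : seq nat) : Prop := forall x y z : nat,
  x \in w -> y \in w -> z \in w ->
  index x w < index y w -> index y w < index z w -> z < y -> y < x ->
  exists p : nat, [/\ p \in w, index x w < index p w, index p w < index z w,
                p != y & p < x].

(* [sim] for the inverse: the roles of position and value are exchanged. *)
Definition isim (w : seq nat) : Prop := forall x y z : nat,
  x \in w -> y \in w -> z \in w ->
  index x w < index y w -> index y w < index z w -> z < y -> y < x ->
  exists p : nat, [/\ p \in w, z < p, p < x, p != y & index p w < index z w].

Definition good (w : seq nat) : Prop := [/\ av132 w, sim w & isim w].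

(** The three conditions compare letters only with letters and positions only with positions, so an
    order-preserving relabelling is harmless. It is applied to the shifts [addn r] and [S] and to
    [bump v]. *)
Lemma good_map (h : nat -> nat) (w : seq nat) :
  {mono h : x y / x < y} -> good (map h w) <-> good w.
Proof.
move=> hm.
have hI : injective h.
  move=> x y e; move: (hm x y) (hm y x); rewrite e ltnn; lia.
have idx x : index (h x) (map h w) = index x w by rewrite index_map.
have hin x : (h x \in map h w) = (x \in w) by rewrite mem_map.
split=> -[gA gS gT]; split.
- move=> x y z xw yw zw xy yz xz zy.
  by apply: (gA (h x) (h y) (h z)); rewrite ?hin ?idx ?hm.
- move=> x y z xw yw zw xy yz zy yx.
  have [] := gS (h x) (h y) (h z); rewrite ?hin ?idx ?hm //.
  move=> _ [/mapP[p pw ->]]; rewrite !idx hm (inj_eq hI) => *.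
  by exists p.
- move=> x y z xw yw zw xy yz zy yx.
  have [] := gT (h x) (h y) (h z); rewrite ?hin ?idx ?hm //.
  move=> _ [/mapP[p pw ->]]; rewrite !idx !hm (inj_eq hI) => *.
  by exists p.
- move=> _ _ _ /mapP[x xw ->] /mapP[y yw ->] /mapP[z zw ->].
  by rewrite !idx !hm; apply: gA.
- move=> _ _ _ /mapP[x xw ->] /mapP[y yw ->] /mapP[z zw ->].
  rewrite !idx !hm => xy yz zy yx.
  have [p [*]] := gS _ _ _ xw yw zw xy yz zy yx.
  by exists (h p); rewrite !idx hm hin (inj_eq hI).
- move=> _ _ _ /mapP[x xw ->] /mapP[y yw ->] /mapP[z zw ->].
  rewrite !idx !hm => xy yz zy yx.
  have [p [*]] := gT _ _ _ xw yw zw xy yz zy yx.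
  by exists (h p); rewrite !idx !hm hin (inj_eq hI).
Qed.

(** * Merging two letters adjacent in position and value *)

Section Insert.

Variables (A B : seq nat) (v : nat).
Let w := A ++ v :: v.+1 :: B.
Let w0 := A ++ v.+1 :: B.
Let a := size A.
Hypothesis U : uniq w.

(** The merge on letters; [v.+1] is the copy that survives in [w0]. *)
Let c (x : nat) := if x == v then v.+1 else x.

(** The full table of values and positions under the merge, as a disjunction that [lia] can
    split. *)
Lemma index_insert (x : nat) : x \in w ->
  c x \in w0 /\
  ((x = v /\ c x = v.+1 /\ index x w = a /\ index (c x) w0 = a) \/
   (x = v.+1 /\ c x = v.+1 /\ index x w = a.+1 /\ index (c x) w0 = a) \/
   (x <> v /\ x <> v.+1 /\ c x = x /\
     index x w = index (c x) w0 /\ index (c x) w0 < a) \/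
   (x <> v /\ x <> v.+1 /\ c x = x /\
     index x w = (index (c x) w0).+1 /\ a < index (c x) w0)).
Proof.
move: U; rewrite cat_uniq /= => /and3P[_ nA /andP[]].
rewrite !inE !negb_or in nA *.
case/and3P: nA => vA v1A _ /andP[vv1 vB] _.
rewrite /w /w0 /c !mem_cat !inE !index_cat /= eq_sym [v.+1 == x]eq_sym.
case: (eqVneq x v) => [-> _|xv /=].
  by rewrite eqxx orbT (negPf vA) (negPf v1A) addn0; split=> //; left.
rewrite [v.+1 == x]eq_sym.
case: (eqVneq x v.+1) => [-> _|xv1 /=].
  by rewrite orbT (negPf v1A) addn0 addn1; split=> //; right; left.
case: (boolP (x \in A)) => /= xA xB.
  have lt : index x A < size A by rewrite index_mem.
  by split=> //; right; right; left; do !split=> //; apply/eqP.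
split=> //; right; right; right.
by rewrite !addnS ltnS leq_addr; do !split=> //; apply/eqP.
Qed.

Lemma index_inserted (x : nat) : x \in w0 ->
  x \in w /\
  ((x = v.+1 /\ index x w = a.+1 /\ index x w0 = a) \/
   (x <> v /\ x <> v.+1 /\ index x w = index x w0 /\ index x w0 < a) \/
   (x <> v /\ x <> v.+1 /\ index x w = (index x w0).+1 /\ a < index x w0)).
Proof.
move=> xw0.
have vnin : v \notin w0.
  by move: U; rewrite /w -(cat1s v) uniq_catCA /=; case/andP.
have xw : x \in w.
  by move: xw0; rewrite !mem_cat !inE => /orP[->|/orP[]->]; rewrite ?orbT.
split=> //; have := index_insert xw; rewrite /c.
by case: eqP xw0 => [->|nxv _]; [rewrite (negPf vnin) | tauto].
Qed.

(** The letters [v] and [v.+1] form an ascent with nothing between them in position or value, so no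
    132 pattern and no decreasing triple contains both. Each such triple of [w] therefore merges to
    one of the same kind in [w0], and a witness found there also serves in [w]. *)
Lemma good_insert : good w0 -> good w.
Proof.
case=> gA gS gT; split.
- move=> x y z xw yw zw.
  move: (index_insert xw) (index_insert yw) (index_insert zw).
  case=> cx Hx [cy Hy] [cz Hz] xy yz xz zy.
  apply: (gA (c x) (c y) (c z)) => //; clear -Hx Hy Hz xy yz xz zy; lia.
- move=> x y z xw yw zw.
  move: (index_insert xw) (index_insert yw) (index_insert zw).
  case=> cx Hx [cy Hy] [cz Hz] xy yz zy yx.
  have [||||p [pw p1 p2 p3 p4]] := gS _ _ _ cx cy cz;
    [clear -Hx Hy Hz xy yz zy yx; lia..|].
  exists p; have [pw' Hp] := index_inserted pw;
  clear -Hx Hy Hz xy yz zy yx Hp pw' p1 p2 p3 p4.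
  by split=> //; lia.
- move=> x y z xw yw zw.
  move: (index_insert xw) (index_insert yw) (index_insert zw).
  case=> cx Hx [cy Hy] [cz Hz] xy yz zy yx.
  have [||||p [pw p1 p2 p3 p4]] := gT _ _ _ cx cy cz;
    [clear -Hx Hy Hz xy yz zy yx; lia..|].
  exists p; have [pw' Hp] := index_inserted pw;
  clear -Hx Hy Hz xy yz zy yx Hp pw' p1 p2 p3 p4.
  by split=> //; lia.
Qed.

(** The side condition covers the two intended situations, [A] empty and [v = 0]. The danger is that
    a witness in [w] merges with a letter of the triple. *)
Lemma good_remove :
  (forall x, x \in w0 -> 0 < a -> a < index x w0 -> v < x) ->
  good w -> good w0.
Proof.
move=> H [gA gS gT].
have vw : v \in w /\ index v w = a.
  have vin : v \in w by rewrite mem_cat inE eqxx orbT.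
  split=> //; have := index_insert vin; lia.
split.
- move=> x y z xw yw zw xy yz xz zy.
  have [xw' Hx] := index_inserted xw.
  have [yw' Hy] := index_inserted yw.
  have [zw' Hz] := index_inserted zw.
  by apply: (gA x y z) => //; clear -Hx Hy Hz xy yz xz zy; lia.
- move=> x y z xw yw zw xy yz zy yx.
  have [xw' Hx] := index_inserted xw.
  have [yw' Hy] := index_inserted yw.
  have [zw' Hz] := index_inserted zw.
  (* The merged letter cannot be the middle of a decreasing triple: otherwise [v] could be the
     witness in [w], and it would merge into [y]. *)
  have {}H : z < v.+1 -> index y w0 <> a.
    by move=> zv ya; have := H z zw; clear -zv ya xy yz; lia.
  (* If the triple ends at the merged letter, the left copy [v] is used instead: a witness must
     precede it, so it is neither copy. *)
  have [z' [zw2 Hz']] : exists z' : nat, z' \in w /\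
      ((z = v.+1 /\ z' = v /\ index z' w = a) \/
        (z <> v.+1 /\ z' = z /\ index z' w = index z w)).
    case: (eqVneq z v.+1) => zv; first by exists v; case: vw; split=> //; left.
    by exists z; split=> //; right; do !split=> //; apply/eqP.
  have [||||p [pw p1 p2 p3 p4]] := gS x y z' xw' yw' zw2;
    [clear -Hx Hy Hz Hz' vw xy yz zy yx; case: vw => _; lia..|].
  have [cp Hp] := index_insert pw.
  exists (c p); clear -H Hx Hy Hz Hz' cp Hp p1 p2 p3 p4 xy yz zy yx.
  by split=> //; lia.
- move=> x y z xw yw zw xy yz zy yx.
  have [xw' Hx] := index_inserted xw.
  have [yw' Hy] := index_inserted yw.
  have [zw' Hz] := index_inserted zw.
  have {}H : z < v.+1 -> index y w0 <> a.
    by move=> zv ya; have := H z zw; clear -zv ya xy yz; lia.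
  (* Dually, if the triple starts at the merged letter, the lower copy [v] is used, so that a
     witness is smaller than both copies. *)
  have [x' [xw2 Hx']] : exists x' : nat, x' \in w /\
      ((x = v.+1 /\ x' = v /\ index x' w = a) \/
        (x <> v.+1 /\ x' = x /\ index x' w = index x w)).
    case: (eqVneq x v.+1) => zv; first by exists v; case: vw; split=> //; left.
    by exists x; split=> //; right; do !split=> //; apply/eqP.
  have [||||p [pw p1 p2 p3 p4]] := gT x' y z xw2 yw' zw';
    [clear -Hx Hy Hz Hx' vw xy yz zy yx; case: vw => _; lia..|].
  have [cp Hp] := index_insert pw.
  exists (c p); clear -H Hx Hy Hz Hx' cp Hp p1 p2 p3 p4 xy yz zy yx.
  by split=> //; lia.
Qed.

End Insert.

(** * Cutting a word at its maximum *)

Section Glue.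

Variables (L R : seq nat) (r m : nat).
Hypothesis uR : uniq R.
Let w := L ++ m :: R.
Hypothesis Lmem : forall x, (x \in L) = (r <= x < m).
Hypothesis Rmem : forall x, (x \in R) = (x < r).
Hypothesis rm : r <= m.

Lemma index_glue (x : nat) : x \in w ->
  (r <= x < m /\ x \in L /\ index x w = index x L /\ index x L < size L) \/
  (x = m /\ index x w = size L) \/
  (x < r /\ x \in R /\ index x w = (size L + index x R).+1
    /\ index x R < size R).
Proof.
rewrite /w mem_cat inE index_cat /= !index_mem.
case: (boolP (x \in L)) => /= xL.
  by left; rewrite -Lmem xL.
case: eqVneq => [->|_] /=; first by right; left; rewrite addn0.
by move=> xR; right; right; rewrite -Rmem xR addnS.
Qed.

Lemma glue_memL (x : nat) : x \in L -> x \in w /\ index x w = index x L.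
Proof. by move=> xL; rewrite /w mem_cat index_cat xL. Qed.

Lemma glue_memR (x : nat) :
  x \in R -> x \in w /\ index x w = (size L + index x R).+1.
Proof.
move=> xR; rewrite /w mem_cat inE index_cat /= xR !orbT; split=> //.
move: xR; rewrite Rmem Lmem => xr; rewrite leqNgt xr /=.
by case: eqVneq => e; [move: xr rm; rewrite -e; lia | rewrite addnS].
Qed.

Definition head_asc (s : seq nat) : Prop := forall y z : nat,
  y \in s -> z \in s -> index y s = 0 -> index z s = 1 -> y < z.

(** All of [L] lies above [R], so a 132 pattern stays within one part. A decreasing triple not
    inside one part has either two letters in [L] or two in [R]; the two extra conditions then
    supply a witness in that part, valid for [sim] and [isim] alike. *)
Lemma good_glue : good L -> good R ->
  head_asc R -> (L <> [::] -> R <> [::] -> index r L < index r.+1 L) ->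
  good w.
Proof.
move=> [LA LS LT] [RA RS RT] Rasc Lasc.
have R0 z : z \in R -> 0 < index z R ->
    exists p : nat, [/\ p \in R, index p R = 0 & p <> z].
  move=> zR z0; exists (nth 0 R 0).
  have szR : 0 < size R by case: (R) zR.
  rewrite mem_nth // index_uniq //; split=> // e.
  by move: z0; rewrite -e index_uniq.
have R1 z : z \in R -> 1 < index z R ->
    exists p : nat, [/\ p \in R, index p R = 1 & p <> z].
  move=> zR z1; exists (nth 0 R 1).
  have szR : 1 < size R by apply: leq_trans z1 _; rewrite ltnW // index_mem.
  rewrite mem_nth // index_uniq //; split=> // e.
  by move: z1; rewrite -e index_uniq.
(* The witness is one of the two least letters of [L]: [r.+1] if [y] is [r], and [r] otherwise,
   since [r] before [x] would make [r], [x], [y] a 132 pattern. *)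
have lowL x y z : x \in L -> y \in L -> z \in R -> index x L < index y L ->
    y < x ->
    exists p : nat, [/\ p \in L, index x L < index p L, p != y & p < x].
  move=> xL yL zR xy yx.
  have {}Lasc : index r L < index r.+1 L.
    by apply: Lasc; [case: (L) xL | case: (R) zR].
  have rL : r \in L by move: yL; rewrite !Lmem; move: xL; rewrite Lmem; lia.
  have r1L : r.+1 \in L by move: yL; rewrite !Lmem; move: xL; rewrite Lmem; lia.
  case: (eqVneq y r) => [yr|yr].
    exists r.+1; rewrite r1L; split=> //; first by rewrite yr in xy; lia.
      by rewrite yr; lia.
    rewrite yr in xy yx; case: (eqVneq x r.+1) => [xr|]; last by lia.
    by rewrite xr in xy; lia.
  exists r; rewrite rL; split=> //; first last.
  - by move: yL; rewrite Lmem; lia.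
  - by rewrite eq_sym.
  rewrite ltnNge; apply/negP => rx.
  have nxr : r != x by move: yL; rewrite Lmem; lia.
  have {}rx : index r L < index x L.
    rewrite ltn_neqAle rx andbT; apply: contra nxr => /eqP e.
    by rewrite -(nth_index 0 rL) e nth_index.
  by apply: (LA r x y) => //; move: yL; rewrite Lmem; lia.
(* The witness is one of the first two letters of [R]: the second if [y] is the first, and the first
   otherwise, since below [z] it would form a 132 pattern with [y] and [z]. *)
have Rother y z : y \in R -> z \in R -> index y R < index z R -> z < y ->
    exists p : nat, [/\ p \in R, index p R < index z R, p != y & z < p].
  move=> yR zR yz zy.
  case: (posnP (index y R)) => y0.
    have z1 : 1 < index z R.
      rewrite ltn_neqAle (leq_trans _ yz) // andbT eq_sym.
      by apply/eqP => z1; have := Rasc y z yR zR y0 z1; lia.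
    have [p [pR p1 pz]] := R1 z zR z1.
    have := Rasc y p yR pR y0 p1.
    by exists p; split=> //; lia.
  have [|p [pR p0 pz]] := R0 z zR; first lia.
  exists p; split=> //; first lia.
    by apply/eqP=> e; rewrite e in p0; lia.
  rewrite ltnNge; apply/negP => pz'.
  by apply: (RA p y z) => //; lia.
split.
- move=> x y z /index_glue Hx /index_glue Hy /index_glue Hz xy yz xz zy.
  case: Hx => [|[|]] Hx; case: Hy => [|[|]] Hy; case: Hz => [|[|]] Hz; try lia.
    by apply: (LA x y z); tauto || lia.
  by apply: (RA x y z); tauto || lia.
- move=> x y z /index_glue Hx /index_glue Hy /index_glue Hz xy yz zy yx.
  case: Hx => [|[|]] Hx; case: Hy => [|[|]] Hy; case: Hz => [|[|]] Hz; try lia.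
  (* The surviving cases are, in order, LLL, LLR, LRR, mRR and RRR, according to the parts
     containing [x], [y], [z]. *)
  + have [|||||||p [pL p1 p2 p3 p4]] := LS x y z; try tauto; try lia.
    by exists p; have [? ->] := glue_memL pL; split=> //; lia.
  + have [|||||p [pL p1 p2 p3]] := lowL x y z; try tauto; try lia.
    have plt : index p L < size L by rewrite index_mem.
    by exists p; have [? ->] := glue_memL pL; split=> //; lia.
  + have [||||p [pR p1 p2 p3]] := @Rother y z; try tauto; try lia.
    have prm : p < r by rewrite -Rmem.
    by exists p; have [? ->] := glue_memR pR; split=> //; lia.
  + have [||||p [pR p1 p2 p3]] := @Rother y z; try tauto; try lia.
    have prm : p < r by rewrite -Rmem.
    by exists p; have [? ->] := glue_memR pR; split=> //; lia.
  + have [|||||||p [pR p1 p2 p3 p4]] := RS x y z; try tauto; try lia.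
    by exists p; have [? ->] := glue_memR pR; split=> //; lia.
- move=> x y z /index_glue Hx /index_glue Hy /index_glue Hz xy yz zy yx.
  case: Hx => [|[|]] Hx; case: Hy => [|[|]] Hy; case: Hz => [|[|]] Hz; try lia.
  + have [|||||||p [pL p1 p2 p3 p4]] := LT x y z; try tauto; try lia.
    by exists p; have [? ->] := glue_memL pL; split=> //; lia.
  + have [|||||p [pL p1 p2 p3]] := lowL x y z; try tauto; try lia.
    have plt : index p L < size L by rewrite index_mem.
    have prm : r <= p < m by rewrite -Lmem.
    by exists p; have [? ->] := glue_memL pL; split=> //; lia.
  + have [||||p [pR p1 p2 p3]] := @Rother y z; try tauto; try lia.
    have prm : p < r by rewrite -Rmem.
    by exists p; have [? ->] := glue_memR pR; split=> //; lia.
  + have [||||p [pR p1 p2 p3]] := @Rother y z; try tauto; try lia.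
    have prm : p < r by rewrite -Rmem.
    by exists p; have [? ->] := glue_memR pR; split=> //; lia.
  + have [|||||||p [pR p1 p2 p3 p4]] := RT x y z; try tauto; try lia.
    by exists p; have [? ->] := glue_memR pR; split=> //; lia.
Qed.

Lemma glue_inL (x : nat) : x \in w -> index x w < size L \/ r <= x < m ->
  x \in L /\ index x w = index x L.
Proof. by move=> /index_glue[|[|]] H lt; split; (tauto || lia). Qed.

Lemma glue_inR (x : nat) : x \in w -> size L < index x w \/ x < r ->
  x \in R /\ index x w = (size L + index x R).+1.
Proof. by move=> /index_glue[|[|]] H lt; split; (tauto || lia). Qed.

(** The extra conditions are forced. If [R] began with a descent, [m] and its first two letters
    would leave no position for a witness; if [r.+1] preceded [r], the triple [r.+1], [r], [r.-1]
    would leave no value for one. *)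
Lemma good_unglue : good w ->
  [/\ good L, good R, head_asc R
    & L <> [::] -> R <> [::] -> index r L < index r.+1 L].
Proof.
have mw : m \in w by rewrite mem_cat inE eqxx orbT.
have mi : index m w = size L by have := index_glue mw; lia.
case=> [wA wS wT]; split.
- split.
  + move=> x y z /glue_memL[xw Hx] /glue_memL[yw Hy] /glue_memL[zw Hz].
    by rewrite -Hx -Hy -Hz; apply: wA.
  + move=> x y z /glue_memL[xw Hx] /glue_memL[yw Hy] zL.
    have [zw Hz] := glue_memL zL; rewrite -Hx -Hy -Hz => xy yz zy yx.
    have [p [pw p1 p2 p3 p4]] := wS x y z xw yw zw xy yz zy yx.
    have [|pL Hp] := glue_inL pw.
      by left; apply: ltn_trans p2 _; rewrite Hz index_mem.
    by exists p; rewrite -Hp.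
  + move=> x y z xL /glue_memL[yw Hy] zL.
    have [xw Hx] := glue_memL xL; have [zw Hz] := glue_memL zL.
    rewrite -Hx -Hy -Hz => xy yz zy yx.
    have [p [pw p1 p2 p3 p4]] := wT x y z xw yw zw xy yz zy yx.
    have [|pL Hp] := glue_inL pw; last by exists p; rewrite -Hp.
    by right; move: xL zL; rewrite !Lmem; clear -p1 p2; lia.
- split.
  + move=> x y z /glue_memR[xw Hx] /glue_memR[yw Hy] /glue_memR[zw Hz].
    rewrite -(ltn_add2l (size L).+1) -(ltn_add2l (size L).+1 (index y R)).
    by rewrite !addSn -Hx -Hy -Hz; apply: wA.
  + move=> x y z /glue_memR[xw Hx] /glue_memR[yw Hy] /glue_memR[zw Hz].
    rewrite -(ltn_add2l (size L).+1) -(ltn_add2l (size L).+1 (index y R)).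
    rewrite !addSn -Hx -Hy -Hz => xy yz zy yx.
    have [p [pw p1 p2 p3 p4]] := wS x y z xw yw zw xy yz zy yx.
    have [|pR Hp] := glue_inR pw; first by left; clear -Hx p1; lia.
    by exists p; split=> //; clear -Hx Hz Hp p1 p2; lia.
  + move=> x y z xR /glue_memR[yw Hy] /glue_memR[zw Hz].
    have [xw Hx] := glue_memR xR.
    rewrite -(ltn_add2l (size L).+1) -(ltn_add2l (size L).+1 (index y R)).
    rewrite !addSn -Hx -Hy -Hz => xy yz zy yx.
    have [p [pw p1 p2 p3 p4]] := wT x y z xw yw zw xy yz zy yx.
    have [|pR Hp] := glue_inR pw.
      by right; apply: ltn_trans p2 _; rewrite -Rmem.
    by exists p; split=> //; clear -Hx Hz Hp p4; lia.
- move=> y z yR zR y0 z1; rewrite ltnNge; apply/negP => zy.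
  have [yw Hy] := glue_memR yR; have [zw Hz] := glue_memR zR.
  have ym : y < m by apply: leq_trans rm; rewrite -Rmem.
  have yz : z <> y by move=> e; rewrite e y0 in z1.
  have [||||p [pw p1 p2 p3 p4]] := wS m y z mw yw zw;
    [clear -mi Hy Hz ym yz zy y0 z1; lia..|].
  have [|pR Hp] := glue_inR pw; first by left; rewrite -mi.
  case/eqP: p3; rewrite -(nth_index 0 pR) -(nth_index 0 yR); congr nth.
  clear -Hp Hz p2 y0 z1; lia.
- move=> Ln Rn; rewrite ltnNge; apply/negP => le.
  have [x xL] : exists x, x \in L.
    by case: (L) Ln => // x s; exists x; rewrite inE eqxx.
  have [y yR] : exists y, y \in R.
    by case: (R) Rn => // y s; exists y; rewrite inE eqxx.
  have rL : r \in L by move: xL; rewrite !Lmem; clear; lia.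
  (* An absent [r.+1] would have index [size L], beyond that of [r]; so a one-letter [L] meets the
     condition. *)
  have r1L : r.+1 \in L.
    by rewrite -index_mem; apply: leq_ltn_trans le _; rewrite index_mem.
  have zR : r.-1 \in R by move: yR; rewrite !Rmem; clear; lia.
  have r0 : 0 < r by move: yR; rewrite Rmem; clear; lia.
  have [xw Hx] := glue_memL r1L; have [yw Hy] := glue_memL rL.
  have [zw Hz] := glue_memR zR.
  have lt : index r.+1 L != index r L.
    by apply/eqP => e; have := nth_index 0 r1L; rewrite e nth_index // => /n_Sn.
  have rlt : index r L < size L by rewrite index_mem.
  have [||||p [pw p1 p2 p3 p4]] := wT r.+1 r r.-1 xw yw zw;
    [clear -le lt rlt r0 Hx Hy Hz; lia..|clear -p1 p2 p3; lia].
Qed.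

End Glue.

(** * Inflation and gluing of standard words *)

Definition standard (w : seq nat) : Prop :=
  uniq w /\ forall x, (x \in w) = (x < size w).

(* The first letter, resp. the least one, is replaced by two letters adjacent in
position and value, in increasing order; the empty word is sent to [:: 0]. *)
Definition inflate_head (w : seq nat) : seq nat :=
  head 0 w :: map (bump (head 0 w)) w.

Definition inflate_min (w : seq nat) : seq nat :=
  take (index 0 w) (map S w) ++ 0 :: drop (index 0 w) (map S w).

Definition glue (L R : seq nat) : seq nat :=
  map (addn (size R)) L ++ (size L + size R) :: R.

Lemma size_inflate_head w : size (inflate_head w) = (size w).+1.
Proof. by rewrite /= size_map. Qed.

Lemma size_inflate_min w : size (inflate_min w) = (size w).+1.
Proof. by rewrite size_cat /= addnS -size_cat cat_take_drop size_map. Qed.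

Lemma size_glue L R : size (glue L R) = (size L + size R).+1.
Proof. by rewrite size_cat /= size_map addnS. Qed.

Lemma perm_inflate_min w : perm_eq (inflate_min w) (0 :: map S w).
Proof.
rewrite -[X in _ :: X](cat_take_drop (index 0 w)).
exact/permPl/(perm_catCA _ [:: 0]).
Qed.

Lemma standard_bump v s : v <= size s ->
  standard (v :: map (bump v) s) <-> standard s.
Proof.
move=> vs; have bI := can_inj (bumpK v).
have mb k : (bump v k \in v :: map (bump v) s) = (k \in s).
  by rewrite inE (mem_map bI) eq_sym (negPf (neq_bump v k)).
have vn : v \notin map (bump v) s.
  by apply/negP => /mapP[k _ e]; have := neq_bump v k; rewrite -e eqxx.
rewrite /standard cons_uniq vn (map_inj_uniq bI) [size _]/= size_map.
split=> -[us ms]; split=> // x.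
  by rewrite -mb ms /bump; lia.
case: (eqVneq x v) => [->|xv] /=; first by rewrite inE eqxx ltnS vs.
have <- : bump v (unbump v x) = x by rewrite unbumpK // !inE.
by rewrite mb ms /bump; lia.
Qed.

Lemma standard_inflate_head w : standard (inflate_head w) <-> standard w.
Proof.
case: w => [|v w]; first by split=> _; split=> // x; rewrite inE; case: x.
have E : v <= size (v :: w) -> _ := @standard_bump v (v :: w).
split=> sw; apply/E => //.
  by have [_ /(_ v)] := sw; rewrite size_inflate_head inE eqxx => /esym.
by have [_ /(_ v)] := sw; rewrite inE eqxx => /esym /ltnW.
Qed.

Lemma standard_inflate_min w : standard (inflate_min w) <-> standard w.
Proof.
have P := perm_inflate_min w.
rewrite /standard (perm_uniq P) size_inflate_min /= (map_inj_uniq succn_inj).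
have -> : 0 \notin map S w by apply/negP => /mapP[].
split=> -[us ms]; split=> // x.
  by have := ms x.+1; rewrite (perm_mem P) inE /= (mem_map succn_inj).
by rewrite (perm_mem P) inE; case: x => // x; rewrite /= (mem_map succn_inj).
Qed.

Lemma mem_shift r L x : standard L ->
  (x \in map (addn r) L) = (r <= x < size L + r).
Proof.
case=> uL mL; apply/mapP/idP => [[y]|/andP[rx xm]].
  by rewrite mL => ym ->; lia.
by exists (x - r); rewrite ?mL; lia.
Qed.

Lemma standard_glue L R : standard L -> standard R -> standard (glue L R).
Proof.
move=> sL sR; have [uL mL] := sL; have [uR mR] := sR; split.
  rewrite cat_uniq (map_inj_uniq (@addnI _)) uL /= mR uR.
  rewrite mem_shift // ltnn andbF -leqNgt leq_addl andbT /=.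
  by rewrite andbT; apply/hasPn => x; rewrite mR mem_shift //; lia.
by move=> x; rewrite mem_cat inE mem_shift // mR size_glue; lia.
Qed.

Lemma head_asc_inflate_head w : head_asc (inflate_head w).
Proof.
case: w => [|v w] y z yw zw; first by move: zw; rewrite inE => /eqP ->.
move=> y0 z1; rewrite -(nth_index 0 yw) -(nth_index 0 zw) y0 z1 /=.
by rewrite /bump leqnn.
Qed.

Lemma inflate_min_split A B : 0 \notin A ->
  inflate_min (A ++ 0 :: B) = map S A ++ 0 :: 1 :: map S B.
Proof.
move=> nA; rewrite /inflate_min index_cat (negPf nA) /= addn0 map_cat.
by rewrite take_size_cat ?drop_size_cat ?size_map.
Qed.

Lemma split_first (x : nat) (w : seq nat) : x \in w ->
  exists A B, w = A ++ x :: B /\ x \notin A.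
Proof.
elim: w => // y w IH; rewrite inE; case: eqVneq => [->|xy] /=.
  by exists [::], w.
case/IH => A [B [-> nA]]; exists (y :: A), B.
by rewrite inE negb_or xy.
Qed.

Lemma inflate_min_asc w :
  standard w -> index 0 (inflate_min w) < index 1 (inflate_min w).
Proof.
(* For empty [w] the word is [[:: 0]], where the absent letter 1 gets index 1, the size. *)
case: (posnP (size w)) => [/size0nil ->//|w0] sw; have [uw mw] := sw.
have [A [B [e nA]]] := split_first (etrans (mw 0) w0).
have /standard_inflate_min[+ _] := sw; rewrite e inflate_min_split // => U.
have n0 : 0 \notin map S A by apply/negP => /mapP[].
have n1 : 1 \notin map S A by rewrite (mem_map succn_inj).
by rewrite !index_cat (negPf n0) (negPf n1) /= addn0 addn1.
Qed.

Lemma good_small w : size w <= 1 -> good w.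
Proof.
case: w => [|a [|//]] _; split=> // x y z; rewrite !inE.
all: by move=> /eqP -> /eqP -> /eqP ->; rewrite ltnn.
Qed.

(** The merge lemmas with empty prefix: [bump v] turns the head [v] into [v.+1], and the new [v]
    stands just before it. *)
Lemma good_inflate_head w : standard w -> good (inflate_head w) <-> good w.
Proof.
case: w => [|v w] sw; first by split=> _; apply: good_small.
have /standard_inflate_head[U _] := sw.
have hm : {mono bump v : x y / x < y} by move=> x y; rewrite /bump; lia.
have e : map (bump v) (v :: w) = v.+1 :: map (bump v) w.
  by rewrite /= {1}/bump leqnn.
move: U; rewrite -(good_map (v :: w) hm) /inflate_head [head _ _]/= e => U.
split; last exact: (@good_insert [::]).
exact: (@good_remove [::] _ _ U).
Qed.

(** The merge lemmas with [v = 0], once [S] has freed the letter 0; the side condition holds because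
    the remaining letters are positive. *)
Lemma good_inflate_min w : standard w -> good (inflate_min w) <-> good w.
Proof.
case: (posnP (size w)) => [/size0nil -> _|w0 sw].
  by split=> _; apply: good_small.
have [uw mw] := sw.
have [A [B [e nA]]] := split_first (etrans (mw 0) w0).
have /standard_inflate_min[+ _] := sw.
have hm : {mono S : x y / x < y} by move=> x y; rewrite ltnS.
rewrite -(good_map w hm) e inflate_min_split // map_cat => U.
split; [apply: good_remove U _ | exact: good_insert U].
by move=> x; rewrite mem_cat inE => /orP[|/orP[/eqP ->//|]] /mapP[k _ ->].
Qed.

(** The initial ascent [x], [y] must have [y = x.+1]: otherwise [x.+1] occurs later and [x], [y],
    [x.+1] is a 132 pattern. So [x] can be deleted and the rest relabelled by [unbump x]. *)
Lemma inflate_head_surj R : standard R -> good R -> head_asc R -> R <> [::] ->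
  exists2 w, standard w & inflate_head w = R.
Proof.
move=> sR [RA _ _] asc; have [uR mR] := sR.
case: R sR RA asc uR mR => [//|x [|y B]] sR RA asc uR mR _.
  have : 0 \in [:: x] by rewrite mR.
  by rewrite inE => /eqP <-; exists [::].
have xR : x \in [:: x, y & B] by rewrite inE eqxx.
have yR : y \in [:: x, y & B] by rewrite !inE eqxx orbT.
have xny : x != y by move: uR; rewrite /= inE negb_or => /andP[/andP[]].
have xy : x < y by apply: asc; rewrite //= ?eqxx ?(negPf xny).
have yx : y = x.+1.
  apply/eqP; rewrite eqn_leq xy andbT leqNgt; apply/negP => lt.
  have x1R : x.+1 \in [:: x, y & B] by move: yR; rewrite !mR; lia.
  have yx1 : (y == x.+1) = false by apply/eqP; lia.
  have xx1 : (x == x.+1) = false by apply/eqP; lia.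
  by apply: (RA x y x.+1); rewrite //= ?eqxx ?(negPf xny) ?yx1 ?xx1.
have sb : map (bump x) (map (unbump x) (y :: B)) = y :: B.
  rewrite -map_comp map_id_in // => k kB; rewrite /= unbumpK // !inE.
  by apply/eqP => e; move: uR; rewrite -e cons_uniq kB.
have hd : head 0 (map (unbump x) (y :: B)) = x.
  by rewrite /= yx /unbump ltnSn subn1.
have eD : inflate_head (map (unbump x) (y :: B)) = [:: x, y & B].
  by rewrite /inflate_head hd sb.
exists (map (unbump x) (y :: B)) => //.
by apply/standard_inflate_head; rewrite eD.
Qed.

(** The letter [y] following 0, if any, must be 1: otherwise 1 occurs further right and 0, [y], 1 is
    a 132 pattern. If nothing follows 0, then 1 is absent and [L] is [[:: 0]]. *)
Lemma inflate_min_surj L : standard L -> good L -> L <> [::] ->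
  index 0 L < index 1 L -> exists2 w, standard w & inflate_min w = L.
Proof.
move=> sL [LA _ _] Ln lt; have [uL mL] := sL.
have L0 : 0 \in L by rewrite mL; case: (L) Ln.
have [A [B [e nA]]] := split_first L0.
have n1 : 1 \notin A.
  apply/negP => A1; move: lt; rewrite e !index_cat A1 (negPf nA) /= addn0.
  by rewrite ltnNge index_size.
case: B => [|y B] in e *.
  suff A0 : A = [::] by exists [::]; rewrite // e A0.
  apply/size0nil; move: (mL 1); rewrite e mem_cat (negPf n1) inE size_cat /=.
  lia.
have y1 : y = 1.
  have yL : y \in L by rewrite e mem_cat !inE eqxx !orbT.
  have y0 : y != 0.
    move: uL; rewrite e cat_uniq => /and3P[_ _] /=.
    by rewrite inE negb_or eq_sym => /andP[/andP[]].
  have yA : y \notin A.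
    move: uL; rewrite e uniq_catC cat_uniq => /and3P[_ /hasPn H _].
    by apply/negP => /H; rewrite !inE eqxx orbT.
  apply/eqP/negPn/negP => yn1.
  have L1 : 1 \in L by move: yL; rewrite !mL; lia.
  apply: (LA 0 y 1) => //; last lia.
    rewrite e !index_cat (negPf nA) (negPf yA) /= !eqxx eq_sym.
    by rewrite (negPf y0) ltn_add2l.
  rewrite e !index_cat (negPf n1) (negPf yA) /= !eqxx eq_sym.
  by rewrite (negPf y0) (negPf yn1) ltn_add2l.
rewrite {}y1 in e.
have B0 : 0 \notin B.
  by move: uL; rewrite e cat_uniq /= inE => /and4P[].
have sp s : 0 \notin s -> map S (map predn s) = s.
  move=> ns; rewrite -map_comp map_id_in // => k ks /=.
  by rewrite prednK // lt0n; apply: contra ns => /eqP <-.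
have eL : inflate_min (map predn A ++ 0 :: map predn B) = L.
  rewrite inflate_min_split ?sp //.
  by rewrite -(mem_map succn_inj) sp.
exists (map predn A ++ 0 :: map predn B) => //.
by apply/standard_inflate_min; rewrite eL.
Qed.

(** * Trees encoding the good words *)

Inductive tree : Type :=
  Leaf | Lev of tree | Hill of tree | Peak of tree & tree.

(** Inflated words are nonempty, so [Lev] has nothing after the maximum, [Hill] nothing before it,
    and [Peak] something on both sides. The nodes add 1, 2 and 3 letters, as in the terms [z M],
    [z^2 M] and [z^3 M^2]. *)
Fixpoint word (t : tree) : seq nat :=
  match t with
  | Leaf => [::]
  | Lev t => glue (word t) [::]
  | Hill t => glue [::] (inflate_head (word t))
  | Peak t u => glue (inflate_min (word t)) (inflate_head (word u))
  end.

Lemma good_glueE L R : standard L -> standard R -> good (glue L R) <->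
  [/\ good L, good R, head_asc R
    & L <> [::] -> R <> [::] -> index 0 L < index 1 L].
Proof.
move=> sL [uR mR]; set r := size R; set m := size L + r.
have hm : {mono addn r : x y / x < y} by move=> x y; rewrite ltn_add2l.
have mL x : (x \in map (addn r) L) = (r <= x < m) by rewrite mem_shift.
have rm : r <= m by rewrite leq_addl.
have e0 : index r (map (addn r) L) = index 0 L.
  by rewrite -{1}[r]addn0 index_map //; apply: addnI.
have e1 : index r.+1 (map (addn r) L) = index 1 L.
  by rewrite -[r.+1]addn1 index_map //; apply: addnI.
have en : map (addn r) L <> [::] <-> L <> [::] by case: (L).
have gm := good_map L hm; rewrite -e0 -e1.
split=> [|[gL gR aR aL]].
  by case/(good_unglue uR mL mR rm) => /gm gL gR aR aL; split=> // /en.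
by apply: (good_glue uR mL mR rm _ gR aR) => [|/en]; [apply/gm | ].
Qed.

Lemma standard_word t : standard (word t).
Proof.
have s0 : standard [::] by split.
elim: t => [|t IH|t IH|t IHt u IHu] //=; apply: standard_glue => //.
- by apply/standard_inflate_head.
- by apply/standard_inflate_min.
- by apply/standard_inflate_head.
Qed.

Lemma good_word t : good (word t).
Proof.
have g0 : good [::] by apply: good_small.
have s0 : standard [::] by split.
have sW := standard_word.
elim: t => [|t IH|t IH|t IHt u IHu] //=; apply/good_glueE => //.
- by apply/standard_inflate_head.
- by split=> //; [apply/good_inflate_head | apply: head_asc_inflate_head].
- by apply/standard_inflate_min.
- by apply/standard_inflate_head.
- split; [exact/good_inflate_min | exact/good_inflate_head | |].
    exact: head_asc_inflate_head.
  by move=> _ _; apply: inflate_min_asc.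
Qed.

(** A letter [y] brings 0, ..., [y] with it, so [y < size s]; thus [s] lies in an initial interval
    of its own size and fills it. *)
Lemma standard_closed s : uniq s ->
  (forall x y, y \in s -> x < y -> x \in s) -> standard s.
Proof.
move=> us cl; split=> // x.
have sub : {subset s <= iota 0 (size s)}.
  move=> y ys; rewrite mem_iota add0n /=.
  have := @uniq_leq_size _ (iota 0 y.+1) s (iota_uniq _ _).
  rewrite size_iota; apply=> z; rewrite mem_iota add0n => /andP[_].
  by rewrite ltnS leq_eqVlt => /orP[/eqP -> //|]; apply: cl.
have [|_ ->] := uniq_min_size us sub; first by rewrite size_iota.
by rewrite mem_iota.
Qed.

(** Cut at the maximum [m]. A letter before [m] smaller than one after it would form a 132 pattern
    with them, so the right part is closed downwards, hence standard, and the left part is a shifted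
    standard word. *)
Lemma glue_surj w : standard w -> good w -> w <> [::] ->
  exists L R, [/\ standard L, standard R & glue L R = w].
Proof.
move=> sw [wA _ _] wn; have [uw mw] := sw; set m := (size w).-1.
have mE : m.+1 = size w by rewrite /m prednK // lt0n; case: (w) wn.
have mW : m \in w by rewrite mw -mE.
have [A [R [e nA]]] := split_first mW.
have U := uw; rewrite e cat_uniq /= negb_or in U.
case/and4P: U => uA /andP[_ /hasPn dAR] mR uR.
have iA x : x \in A -> index x w < size A /\ x \in w.
  by move=> xA; rewrite e index_cat mem_cat xA index_mem.
have iR x : x \in R -> size A < index x w /\ x \in w.
  move=> xR; have xA := dAR x xR.
  have xm : m == x = false by apply: contraNF mR => /eqP ->.
  rewrite e index_cat mem_cat inE (negPf xA) xR /= xm orbT; split=> //; lia.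
have im : index m w = size A by rewrite e index_cat (negPf nA) /= eqxx addn0.
have RA x y : x \in A -> y \in R -> y < x.
  move=> xA yR; have [xi xw] := iA x xA; have [yi yw] := iR y yR.
  rewrite ltn_neqAle; apply/andP; split.
    by apply/eqP => yx; have := dAR y yR; rewrite yx; case/negP.
  rewrite leqNgt; apply/negP => xy; apply: (wA x m y) => //; rewrite ?im //.
  have := yw; rewrite mw -mE ltnS leq_eqVlt => /orP[/eqP ym|//].
  by move: mR; rewrite -ym yR.
have sR : standard R.
  apply: standard_closed => // x y yR xy; have [_ yw] := iR y yR.
  have : x \in w by rewrite mw; move: yw; rewrite mw; lia.
  rewrite e mem_cat inE => /orP[xA|/orP[/eqP xm|//]].
    by have := RA x y xA yR; lia.
  by move: yw xy; rewrite mw -mE xm; lia.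
have [_ R_mem] := sR; set r := size R.
have szw : m = size A + r by apply/eqP; rewrite -eqSS mE e size_cat /= addnS.
have rA x : x \in A -> r <= x.
  by move=> xA; rewrite leqNgt -R_mem; apply/negP => /(dAR x); rewrite xA.
have eA : map (addn r) (map (subn^~ r) A) = A.
  by rewrite -map_comp map_id_in // => x /rA rx /=; rewrite subnKC.
exists (map (subn^~ r) A), R; split=> //; last first.
  by rewrite /glue eA size_map e -szw.
split=> [|x]; first by rewrite -(map_inj_uniq (@addnI r)) eA.
rewrite -(mem_map (@addnI r)) eA size_map; apply/idP/idP => [xA|xlt].
  have [_] := iA _ xA; rewrite mw -mE szw.
  have : r + x != m by apply: contraNneq nA => <-.
  by rewrite szw; lia.
have : r + x \in w by rewrite mw -mE szw; lia.
rewrite e mem_cat inE R_mem => /orP[//|/orP[/eqP|]]; rewrite ?szw; lia.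
Qed.

(** Strong induction on the length: cut at the maximum and deflate the nonempty parts. Which parts
    are empty selects the constructor. *)
Lemma word_surj w : standard w -> good w -> exists t, word t = w.
Proof.
have [n] := ubnP (size w); elim: n w => // n IH w szw sw gw.
case: (posnP (size w)) => [/size0nil ->|w0]; first by exists Leaf.
have [|L [R [sL sR e]]] := glue_surj sw gw; first by move=> e; rewrite e in w0.
rewrite -e size_glue in szw.
rewrite -e in gw; have [gL gR aR aL] := (good_glueE sL sR).1 gw.
case: (posnP (size R)) => [/size0nil R0|R0].
  have [t et] : exists t, word t = L by apply: IH => //; lia.
  by exists (Lev t); rewrite /= et -e R0.
have Rn : R <> [::] by move=> e0; rewrite e0 in R0.
have [R' sR' eR'] := inflate_head_surj sR gR aR Rn.
have [u eu] : exists u, word u = R'.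
  apply: IH => //; first by rewrite -eR' size_inflate_head in szw; lia.
  by apply/good_inflate_head; rewrite ?eR'.
case: (posnP (size L)) => [/size0nil L0|L0].
  by exists (Hill u); rewrite /= eu eR' -e L0.
have Ln : L <> [::] by move=> e0; rewrite e0 in L0.
have [L' sL' eL'] := inflate_min_surj sL gL Ln (aL Ln Rn).
have [t et] : exists t, word t = L'.
  apply: IH => //; first by rewrite -eL' size_inflate_min in szw; lia.
  by apply/good_inflate_min; rewrite ?eL'.
by exists (Peak t u); rewrite /= eu eR' et eL'.
Qed.

(** The position of the largest letter recovers [size L], hence the cut and the shift. *)
Lemma glue_inj L R L' R' :
  standard L -> standard R -> standard L' -> standard R' ->
  glue L R = glue L' R' -> L = L' /\ R = R'.
Proof.
have idx A B : standard A -> standard B ->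
    index (size A + size B) (glue A B) = size A.
  move=> sA sB; rewrite index_cat mem_shift // ltnn andbF /= eqxx.
  by rewrite size_map addn0.
move=> sL sR sL' sR' e.
have sz : size L + size R = size L' + size R'.
  by have := congr1 size e; rewrite !size_glue => -[].
have szL : size L = size L' by rewrite -(idx L R) // -(idx L' R') // e sz.
have szR : size R = size R' by lia.
move/eqP: e; rewrite /glue eqseq_cat ?size_map // => /andP[/eqP eL /eqP[_ eR]].
by split=> //; apply: (inj_map (@addnI (size R))); rewrite eL szR.
Qed.

Lemma inflate_head_inj : injective inflate_head.
Proof.
move=> w w' e; have := congr1 size e; rewrite !size_inflate_head => -[_].
case: e => -> ; exact: inj_map (can_inj (bumpK _)) _ _.
Qed.

Lemma inflate_min_inj : injective inflate_min.
Proof.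
(* Erasing the letter 0 undoes the insertion without knowing its position. *)
have F w : filter (predC1 0) (inflate_min w) = map S w.
  rewrite /inflate_min filter_cat /= -filter_cat cat_take_drop.
  by apply/all_filterP/allP => _ /mapP[x _ ->].
by move=> w w' e; apply: (inj_map succn_inj); rewrite -!F e.
Qed.

Lemma word_inj : injective word.
Proof.
have s0 : standard [::] by split.
have sW := standard_word.
have sD t : standard (inflate_head (word t)) by apply/standard_inflate_head.
have sl t : standard (inflate_min (word t)) by apply/standard_inflate_min.
have n0 L R : glue L R <> [::] by move/(congr1 size); rewrite size_glue.
elim=> [|t IH|t IH|t IHt u IHu] [|t'|t'|t' u'] //=.
all: try by move/esym/n0.
all: try by move/n0.
all: case/glue_inj=> //.
all: try by move=> _ /(congr1 size); rewrite size_inflate_head.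
all: try by move/(congr1 size); rewrite size_inflate_min.
- by move/IH ->.
- by move=> _ /inflate_head_inj/IH ->.
- by move=> /inflate_min_inj/IHt -> /inflate_head_inj/IHu ->.
Qed.

(** * Trees encoding the UU-free Motzkin paths *)

Fixpoint path_of (t : tree) : seq step :=
  match t with
  | Leaf => [::]
  | Lev t => Level :: path_of t
  | Hill t => [:: Up, Down & path_of t]
  | Peak t u => [:: Up, Level & path_of t ++ Down :: path_of u]
  end.

(* The word is read as a path descending from some height [h] to [0]: its first
passages to heights [h.-1], ..., [0] split it into [h.+1] paths, one tree
each. *)
Fixpoint parse (p : seq step) : seq tree :=
  match p with
  | [::] => [:: Leaf]
  | Level :: p' => if parse p' is t :: ts then Lev t :: ts else [::]
  | Down :: p' => Leaf :: parse p'
  | Up :: Down :: p' => if parse p' is t :: ts then Hill t :: ts else [::]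
  | Up :: Level :: p' =>
      if parse p' is t :: u :: ts then Peak t u :: ts else [::]
  | Up :: Up :: _ => [::]
  | [:: Up] => [::]
  end.

Fixpoint descends (h : nat) (p : seq step) : bool :=
  match p with
  | [::] => h == 0
  | Up :: p' => descends h.+1 p'
  | Level :: p' => descends h p'
  | Down :: p' => if h is h'.+1 then descends h' p' else false
  end.

Fixpoint noUU (p : seq step) : bool :=
  match p with
  | Up :: ((Up :: _) as p') => false
  | _ :: p' => noUU p'
  | [::] => true
  end.

(** This makes the two encodings agree on [n]: each node contributes as many steps as letters. *)
Lemma size_path_of t : size (path_of t) = size (word t).
Proof.
elim: t => // [t IH|t IH|t IHt u IHu].
- by rewrite [RHS]size_glue addn0 -IH.
- by rewrite [RHS]size_glue size_inflate_head -IH.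
- by rewrite [RHS]size_glue size_inflate_head size_inflate_min -IHt -IHu /=
    size_cat addSn.
Qed.

(** The induction needs an arbitrary continuation [p]; its leading [Leaf] is what [t] replaces. In
    the [Peak] case the separating [Down] supplies this [Leaf]. *)
Lemma parse_path_of t p ts :
  parse p = Leaf :: ts -> parse (path_of t ++ p) = t :: ts.
Proof.
elim: t p ts => [|t IH|t IH|t IHt u IHu] p ts e //=; try by rewrite (IH _ _ e).
by rewrite -catA /= (IHt _ (u :: ts)) //= (IHu _ _ e).
Qed.

Lemma path_of_inj : injective path_of.
Proof.
move=> t u e.
have [] : [:: t] = [:: u]; last by [].
by rewrite -(@parse_path_of t [::] [::]) // e (@parse_path_of u [::] [::]).
Qed.

(** The path of a tree returns to its starting height without going below it, so it can be
    skipped. *)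
Lemma descends_path_of t h p : descends h (path_of t ++ p) = descends h p.
Proof.
elim: t h p => [|t IH|t IH|t IHt u IHu] h p //=.
by rewrite -catA IHt /= IHu.
Qed.

Lemma noUU_path_of t p :
  (forall q, p <> Up :: q) -> noUU p -> noUU (path_of t ++ p).
Proof.
elim: t p => [|t IH|t IH|t IHt u IHu] p pU np //=; try exact: IH.
by rewrite -catA; apply: IHt => //; apply: IHu.
Qed.

(** Reverses the first-passage decomposition, each [Down] being a first passage. The empty list only
    gets a default value, since a path from height [h] gives [h.+1] trees. *)
Definition unparse (ts : seq tree) : seq step :=
  if ts is t :: ts' then
    path_of t ++ flatten [seq Down :: path_of u | u <- ts'] else [::].

Lemma unparse_surj h p : descends h p -> noUU p ->
  exists2 ts, size ts = h.+1 & unparse ts = p.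
Proof.
have [n] := ubnP (size p); elim: n h p => // n IH h [|[|/=|] p].
- by move=> _ /eqP -> _; exists [:: Leaf].
- case: p => [|[//|p|p]] //= sz d nU.
    have [|[//|t ts] [szt] <-] := IH h p _ d nU; first by lia.
    by exists (Hill t :: ts); rewrite //= szt.
  (* The rest starts at height [h.+1], so it yields at least two trees: [t] ends just before the
     first return to [h], and [u] starts there. *)
  have [|[//|t [//|u ts]] [szt] <-] := IH h.+1 p _ d nU; first by lia.
  by exists (Peak t u :: ts); rewrite //= ?szt // -catA.
- case: h => // h sz d nU.
  have [|[//|t ts] [szt] <-] := IH h p _ d nU; first by lia.
  by exists [:: Leaf, t & ts]; rewrite //= szt.
- move=> sz d nU.
  have [|[//|t ts] [szt] <-] := IH h p _ d nU; first by rewrite /= in sz; lia.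
  by exists (Lev t :: ts); rewrite //= szt.
Qed.

Lemma path_of_surj p : descends 0 p -> noUU p -> exists t, path_of t = p.
Proof.
move=> d nU; have [[//|t [|//]] _ <-] := unparse_surj d nU.
by exists t; rewrite /= cats0.
Qed.

(** The starting height [h] is arbitrary so that induction can absorb the first step into it. *)
Lemma motzkin_descends h (p : seq step) : reflect
  ((forall k, k <= size p -> (0 <= h%:Z + height p k)%R) /\
   (h%:Z + height p (size p))%R = 0%R) (descends h p).
Proof.
have h0 q : height q 0 = 0%R by rewrite /height take0 big_nil.
have hS a q k : height (a :: q) k.+1 = (rise a + height q k)%R.
  by rewrite /height /= big_cons.
elim: p h => [|a p IH] h.
  apply: (iffP eqP) => /= [->|[_]]; last by rewrite h0 addr0 => -[].
  by rewrite h0; split=> // k; rewrite leqn0 => /eqP ->; rewrite h0.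
have E h' : (h'%:Z = h%:Z + rise a)%R -> reflect
  ((forall k, k <= size (a :: p) -> (0 <= h%:Z + height (a :: p) k)%R) /\
   (h%:Z + height (a :: p) (size (a :: p)))%R = 0%R) (descends h' p).
  move=> eh; apply: (iffP (IH h')) => -[Hk H0]; split.
  - by case=> [|k] lek; rewrite ?h0 ?addr0 // hS addrA -eh; apply: Hk.
  - by rewrite /= hS addrA -eh.
  - by move=> k lek; rewrite eh -addrA -hS; apply: Hk.
  - by rewrite eh -addrA -hS.
case: a E => E /=.
- by apply: E; rewrite /= -PoszD addn1.
- case: h E => [|h] E; last by apply: E; rewrite /= -addn1 PoszD addrK.
  by right => -[/(_ 1 isT)]; rewrite hS h0.
- by apply: E; rewrite addr0.
Qed.

Lemma motzkinE n (p : n.-tuple step) : motzkin p = descends 0 p.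
Proof.
apply/andP/motzkin_descends; rewrite size_tuple add0r => -[H /eqP H0].
  split=> // k lek; rewrite add0r.
  by have /forallP/(_ (Ordinal (lek : k < n.+1))) := H.
split=> //.
by apply/forallP => k; rewrite -[height _ _]add0r H // -ltnS.
Qed.

Lemma noUUE p : no_consecutive_up p = noUU p.
Proof.
rewrite /no_consecutive_up; apply/existsPn/idP => [H|].
  have {}H i : i.+1 < size p -> nth Level p i = Up -> nth Level p i.+1 <> Up.
    move=> lt e0 e1; have := H (Ordinal (ltnW lt : i < size p)).
    by rewrite /= lt e0 e1 eqxx.
  elim: p H => // a p IH H.
  have {}IH : noUU p by apply: IH => i; apply: (H i.+1).
  by case: a p H IH => [[|[] p]|p|p] //= /(_ 0 isT erefl).
move=> nU [i lt] /=; apply/negP => /and3P[{}lt].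
move=> /eqP e0 /eqP e1.
elim: p i nU lt e0 e1 => // a p IH [|i] nU.
  by case: a p nU {IH} => [[|[] p]|p|p].
apply: IH; by case: a p nU => [[|[] p]|p|p].
Qed.

(** * From permutations to conditions on words *)

Lemma index_filter_ltn (P : pred nat) (w : seq nat) (x y : nat) :
  x \in filter P w -> y \in filter P w ->
  (index x (filter P w) < index y (filter P w)) = (index x w < index y w).
Proof.
rewrite !mem_filter => /andP[Px xw] /andP[Py yw].
elim: w xw yw => // a w IH; rewrite !inE /=.
case Pa: (P a) => /=; case: (eqVneq x a) => [xa|xa] /=;
  case: (eqVneq y a) => [ya|ya] //=.
all: rewrite ?[a == x]eq_sym ?[a == y]eq_sym ?(negPf xa) ?(negPf ya).
all: rewrite ?xa ?ya ?eqxx //=.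
all: try by rewrite -?xa -?ya ?Px ?Py in Pa.
all: by move=> xw yw; rewrite ltnS IH.
Qed.

Lemma mem_index (x : nat) (w : seq nat) : index x w < size w -> x \in w.
Proof. by rewrite index_mem. Qed.

Lemma double_descentP (w : seq nat) : uniq w -> reflect
  (exists x y z : nat, [/\ z \in w, index y w = (index x w).+1,
     index z w = (index y w).+1, z < y & y < x])
  (has_double_descent w).
Proof.
move=> uw; apply: (iffP existsP) => [[i /and3P[lt h1 h2]]|].
  exists (nth 0 w i), (nth 0 w i.+1), (nth 0 w i.+2).
  by rewrite mem_nth ?index_uniq // ltnW // ltnW.
case=> x [y [z [zw iy iz zy yx]]].
have lz : (index x w).+2 < size w by rewrite -iy -iz index_mem.
have xw : x \in w by apply: mem_index; lia.
have yw : y \in w by apply: mem_index; lia.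
have li : index x w < size w by rewrite index_mem.
exists (Ordinal li); rewrite /= lz -iy -iz !nth_index //.
by rewrite yx zy.
Qed.

(** If [x], [y], [z] is a double descent of a subword, a witness would survive in that subword next
    to [y], where there is no room for it. Conversely, a triple without witness is a double descent
    of the subword cut at [x]. *)
Lemma sim_subword (n : nat) (w : seq nat) : uniq w ->
  (forall x, x \in w -> 0 < x <= n) ->
  (forall k, k <= n -> ~~ has_double_descent (subword k w)) <-> sim w.
Proof.
move=> uw wn.
have uS k : uniq (subword k w) by rewrite filter_uniq.
have mS k x : (x \in subword k w) = (x \in w) && (x <= k).
  rewrite mem_filter andbC; case xw: (x \in w) => //=.
  by case/andP: (wn x xw) => ->.
split=> [H x y z xw yw zw xy yz zy yx|H k lek]; last first.
  apply/negP => /(double_descentP (uS k))[x [y [z [zS iy iz zy yx]]]].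
  set u := subword k w in zS iy iz *.
  have lz : index z u < size u by rewrite index_mem.
  have yS : y \in u by apply: mem_index; lia.
  have xS : x \in u by apply: mem_index; lia.
  have := xS; rewrite mS => /andP[xw xk].
  have := yS; rewrite mS => /andP[yw _].
  have := zS; rewrite mS => /andP[zw _].
  have [||||p [pw p1 p2 p3 p4]] := H x y z xw yw zw => //.
  - by rewrite -(index_filter_ltn xS yS) -/(subword k w) -/u iy.
  - by rewrite -(index_filter_ltn yS zS) -/(subword k w) -/u iz.
  have pS : p \in u by rewrite mS pw /=; apply: leq_trans (ltnW p4) xk.
  move: p1 p2; rewrite -(index_filter_ltn xS pS) -(index_filter_ltn pS zS).
  rewrite -/(subword k w) -/u => p1 p2.
  case/eqP: p3; rewrite -(nth_index 0 pS) -(nth_index 0 yS); congr nth; lia.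
pose between p :=
  [&& index x w < index p w, index p w < index z w, p != y & p < x].
have [/hasP[p pw /and4P[]]|/hasPn N] := boolP (has between w).
  by exists p.
have /andP[_ xn] := wn x xw.
case/(double_descentP (uS x)): (H x xn); exists x, y, z.
set u := subword x w.
have xS : x \in u by rewrite mS xw leqnn.
have yS : y \in u by rewrite mS yw ltnW.
have zS : z \in u by rewrite mS zw ltnW // (ltn_trans zy).
have lx : index x u < index y u by rewrite index_filter_ltn.
have ly : index y u < index z u by rewrite index_filter_ltn.
have lz : index z u < size u by rewrite index_mem.
(* A letter strictly between [x] and [z] in this subword is smaller than [x], so the absence of
   witnesses makes it [y]. *)
have B i : index x u < i -> i < index z u -> i = index y u.
  move=> xi iz; set q := nth 0 u i.
  have qS : q \in u by rewrite mem_nth // (ltn_trans iz lz).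
  have iq : index q u = i by rewrite index_uniq ?uS // (ltn_trans iz lz).
  have := qS; rewrite mS => /andP[qw qx].
  have := N q qw; rewrite /between.
  rewrite -(index_filter_ltn xS qS) -(index_filter_ltn qS zS).
  rewrite -/(subword x w) -/u iq xi iz /= negb_and negbK -leqNgt.
  case/orP => [/eqP <- //|xq].
  by have qe : q = x; [lia | rewrite qe in iq; lia].
split=> //.
  have [] := ltngtP (index y u) (index x u).+1; [lia | | by []].
  by move=> lt; have := B (index x u).+1; lia.
have [] := ltngtP (index z u) (index y u).+1; [lia | | by []].
by move=> lt; have := B (index y u).+1; lia.
Qed.

Section Oneline.

Variables (n : nat) (s : 'S_n).

Definition perm_word : seq nat := [seq (s i : nat) | i <- enum 'I_n].

Lemma oneline_perm_word : oneline s = map S perm_word.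
Proof. by rewrite -map_comp. Qed.

Lemma size_perm_word : size perm_word = n.
Proof. by rewrite size_map size_enum_ord. Qed.

Lemma standard_perm_word : standard perm_word.
Proof.
split=> [|x].
  by rewrite map_inj_uniq ?enum_uniq // => i j /val_inj/perm_inj.
rewrite size_perm_word; apply/mapP/idP => [[i _ ->] //|xn].
by exists (s^-1%g (Ordinal xn)); rewrite ?mem_enum ?permKV.
Qed.

Lemma uniq_oneline : uniq (oneline s).
Proof.
rewrite oneline_perm_word (map_inj_uniq succn_inj).
by case: standard_perm_word.
Qed.

Lemma index_oneline (i : 'I_n) : index (s i).+1 (oneline s) = i.
Proof.
rewrite /oneline (index_map (f := fun i => (s i).+1)) ?index_enum_ord //.
by move=> j k [] /val_inj/perm_inj.
Qed.

Lemma mem_oneline (i : 'I_n) : (s i).+1 \in oneline s.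
Proof. by apply: map_f; rewrite mem_enum. Qed.

Lemma onelineP (x : nat) : reflect (exists i, x = (s i).+1) (x \in oneline s).
Proof.
by apply: (iffP mapP) => [[i _ ->]|[i ->]]; exists i; rewrite ?mem_enum.
Qed.

Lemma simsunP : reflect (sim (oneline s)) (simsun s).
Proof.
have [|simE Esim] := @sim_subword n _ uniq_oneline.
  by move=> x /onelineP[i ->]; apply: (ltn_ord (s i)).
apply: (iffP forallP) => [H|/Esim H k]; last by apply: H; rewrite -ltnS.
by apply: simE => k lek; apply: (H (Ordinal (lek : k < n.+1))).
Qed.

End Oneline.

(** Inversion exchanges positions and letters; a decreasing triple stays decreasing but is read
    backwards, hence the instances at [k], [j], [i]. *)
Lemma isim_onelineV n (s : 'S_n) : sim (oneline s^-1%g) <-> isim (oneline s).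
Proof.
have iV (i : 'I_n) : index (s^-1%g i).+1 (oneline s^-1%g) = i.
  exact: index_oneline.
have mV (i : 'I_n) : (s^-1%g i).+1 \in oneline s^-1%g := mem_oneline _ i.
split=> H _ _ _ /onelineP[i ->] /onelineP[j ->] /onelineP[k ->].
  rewrite !index_oneline !ltnS => ij jk kj ji.
  have [] := H (s^-1%g (s k)).+1 (s^-1%g (s j)).+1 (s^-1%g (s i)).+1;
    rewrite ?mV ?iV ?permK //.
  move=> _ [/onelineP[q ->]]; rewrite iV eqSS ltnS => q1 q2 q3 q4.
  exists (s (s^-1%g q)).+1; rewrite mem_oneline index_oneline permKV.
  split=> //; rewrite eqSS; apply: contra q3 => /eqP /val_inj ->.
  by rewrite permK.
rewrite !iV !ltnS => ij jk kj ji.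
have [] := H (s (s^-1%g k)).+1 (s (s^-1%g j)).+1 (s (s^-1%g i)).+1;
  rewrite ?mem_oneline ?index_oneline ?permKV //.
move=> _ [/onelineP[q ->]]; rewrite index_oneline eqSS !ltnS => q1 q2 q3 q4.
exists (s^-1%g (s q)).+1; rewrite mV iV permK ltnS eqSS; split=> //.
by apply: contra q3 => /eqP/val_inj ->; rewrite permKV.
Qed.

Lemma p132E (i : 'I_3) : p132 i = nth 0 [:: 0; 2; 1] i :> nat.
Proof.
rewrite permE /= -!val_eqE /= !inordK //.
by case: i => [[|[|[|]]]] //= _; rewrite inordK.
Qed.

Lemma avoids132P n (s : 'S_n) : reflect (av132 (oneline s)) (avoids p132 s).
Proof.
apply: (iffP idP) => [N|A].
  move=> _ _ _ /onelineP[i ->] /onelineP[j ->] /onelineP[k ->].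
  rewrite !index_oneline !ltnS => ij jk ik kj; case/negP: N; apply/existsP.
  exists [ffun t : 'I_3 => nth i [:: i; j; k] t].
  apply/andP; split; apply/forallP => -[[|[|[|//]]] ?];
    apply/forallP => -[[|[|[|//]]] ?];
    rewrite ?p132E !ffunE /=; lia.
apply/negP => /existsP[f /andP[/forallP mf /forallP pf]].

have M (j k : 'I_3) : j < k -> f j < f k.
  by move=> jk; have /forallP/(_ k)/implyP/(_ jk) := mf j.
have P (j k : 'I_3) : (s (f j) < s (f k)) = (p132 j < p132 k).
  by have /forallP/(_ k)/eqP := pf j.
pose o0 : 'I_3 := Ordinal (isT : 0 < 3).
pose o1 : 'I_3 := Ordinal (isT : 1 < 3).
pose o2 : 'I_3 := Ordinal (isT : 2 < 3).
apply: (A (s (f o0)).+1 (s (f o1)).+1 (s (f o2)).+1); rewrite ?mem_oneline //.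
all: by rewrite ?index_oneline ?ltnS ?M ?P ?p132E.
Qed.

Lemma mem_DRS n (s : 'S_n) : s \in DRS n p132 <-> good (perm_word s).
Proof.
have hm : {mono S : x y / x < y} by move=> x y; rewrite ltnS.
rewrite -(good_map (perm_word s) hm) -oneline_perm_word inE.
split=> [/and3P[/avoids132P A /simsunP S /simsunP T]|[A S T]].
  by split=> //; apply/isim_onelineV.
apply/and3P; split; [exact/avoids132P | exact/simsunP | apply/simsunP].
exact/isim_onelineV.
Qed.

(** * Permutations as standard words, and the count *)

Lemma perm_word_inj n : injective (@perm_word n).
Proof.
move=> s t /eq_in_map e; apply/permP => i; apply: val_inj.
by apply: e; rewrite mem_enum.
Qed.

Lemma perm_word_surj n w : standard w -> size w = n ->
  exists s : 'S_n, perm_word s = w.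
Proof.
case=> uw mw sz.
have mn x : (x \in w) = (x < n) by rewrite mw sz.
have lt (i : 'I_n) : nth 0 w i < n by rewrite -mn mem_nth ?sz.
have inj : injective (fun i => Ordinal (lt i)).
  by move=> i j [/eqP]; rewrite nth_uniq ?sz // => /eqP/val_inj.
exists (perm inj); apply: (@eq_from_nth _ 0); rewrite size_perm_word // => i li.
by rewrite (nth_map (Ordinal li)) ?size_enum_ord // permE /= nth_enum_ord.
Qed.

(** Trees appear only as existential witnesses, so the correspondence is a relation; a choice
    function over the finite type [T] turns it into an injection. *)
Lemma leq_card_rel (T U : finType) (A : {set T}) (B : {set U})
    (r : T -> U -> Prop) :
  (forall x, x \in A -> exists2 y, y \in B & r x y) ->
  (forall x x' y, r x y -> r x' y -> x = x') -> #|A| <= #|B|.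
Proof.
move=> tot inj; have [->|[x0 x0A]] := set_0Vmem A; first by rewrite cards0.
have [y0 _ _] := tot x0 x0A.
have [|f Hf] := @fin_all_exists T (fun=> U)
    (fun x y => x \in A -> y \in B /\ r x y).
  move=> x; case xA: (x \in A); last by exists y0.
  by have [y] := tot x xA; exists y.
rewrite -(@card_in_imset _ _ f A).
  by apply/subset_leq_card/subsetP => _ /imsetP[x /Hf[] yB _ ->].
move=> x x' /Hf[_ rx] /Hf[_ rx'] e; apply: inj rx _; by rewrite e.
Qed.

Theorem theorem4p2 (n : nat) : 1 <= n -> #|DRS n p132| = motzkin_no_UU n.
Proof.
(* A permutation and a path correspond when one tree encodes both; each inequality uses surjectivity
   of one encoding and injectivity of the other. *)
move=> _; pose r (s : 'S_n) (p : n.-tuple step) :=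
  exists t, word t = perm_word s /\ path_of t = p.
apply/eqP; rewrite eqn_leq; apply/andP; split.
  apply: (@leq_card_rel _ _ _ _ r) => [s /mem_DRS gs|s s' p].
    have [t et] := word_surj (standard_perm_word s) gs.
    have sz : size (path_of t) == n by rewrite size_path_of et size_perm_word.
    exists (Tuple sz); last by exists t.
    rewrite inE motzkinE noUUE /= -[path_of t]cats0 descends_path_of /=.
    exact: noUU_path_of.
  case=> t [et ep] [t' [et' ep']]; apply: perm_word_inj.
  by rewrite -et -et' (path_of_inj (etrans ep (esym ep'))).
apply: (@leq_card_rel _ _ _ _ (fun p s => r s p)) => [p|p p' s].
  rewrite inE motzkinE noUUE => /andP[d nU].
  have [t et] := path_of_surj d nU.
  have [|s es] := @perm_word_surj n _ (standard_word t).
    by rewrite -size_path_of et size_tuple.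
  exists s; last by exists t.
  by apply/mem_DRS; rewrite es; apply: good_word.
case=> t [et ep] [t' [et' ep']]; apply: val_inj.
by rewrite /= -ep -ep' (word_inj (etrans et (esym et'))).
Qed.
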